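(* Let $G$ be an infinite group and let $\kappa$ be an infinite cardinal with $\kappa<|G|$. Then every slowly oscillating function $h:(G,\mathcal{E}_\kappa)\to\mathbb{R}$ is convergent at infinity, and consequently the corona $\nu_\kappa(G)$ of the coarse space $(G,\mathcal{E}_\kappa)$ is a singleton.
   Context: Coarse structures. A coarse structure on a set $X$ is a family $\mathcal{E}$ of subsets of $X\times X$ such that: each $E\in\mathcal{E}$ contains the diagonal $\triangle_X=\{(x,x):x\in X\}$; if $E,E'\in\mathcal{E}$ then $E\circ E'\in\mathcal{E}$ and $E^{-1}\in\mathcal{E}$, where $E\circ E'=\{(x,y):\exists z\ ((x,z)\in E,\ (z,y)\in E')\}$ and $E^{-1}=\{(y,x):(x,y)\in E\}$; if $E\in\mathcal{E}$ and $\triangle_X\subseteq E'\subseteq E$ then $E'\in\mathcal{E}$; for all $x,y\in X$ there is $E\in\mathcal{E}$ with $(x,y)\in E$. The pair $(X,\mathcal{E})$ is called a coarse space (or ballean). A subfamily $\mathcal{E}'\subseteq\mathcal{E}$ is a base for $\mathcal{E}$ if every $E\in\mathcal{E}$ is contained in some $E'\in\mathcal{E}'$. For $x\in X$, $A\subseteq X$, $E\in\mathcal{E}$ put $E[x]=\{y\in X:(x,y)\in E\}$ and $E[A]=\bigcup_{a\in A}E[a]$. A subset $B\subseteq X$ is bounded if $B\subseteq E[a]$ for some $E\in\mathcal{E}$, $a\in X$. Slowly oscillating functions. A function $f:(X,\mathcal{E})\to\mathbb{R}$ is slowly oscillating if for every $E\in\mathcal{E}$ and every $\varepsilon>0$ there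 is a bounded subset $B\subseteq X$ such that $\operatorname{diam} f(E[x])<\varepsilon$ for each $x\in X\setminus B$. Corona. Give $X$ the discrete topology and let $\beta X$ be its Stone–Čech compactification, viewed as the set of ultrafilters on $X$, with basic open sets $\{q\in\beta X:A\in q\}$, $A\subseteq X$. Let $X^\sharp$ be the set of all $q\in\beta X$ such that each member of $q$ is unbounded in $(X,\mathcal{E})$, with the subspace topology. For $r,q\in X^\sharp$ write $r\,\|\,q$ if there is $E\in\mathcal{E}$ with $E[R]\in q$ for each $R\in r$; this is an equivalence relation on $X^\sharp$. Let $\sim$ be the smallest (by inclusion) equivalence relation on $X^\sharp$ that is closed in $X^\sharp\times X^\sharp$ and contains $\|$. The (Higson's) corona of $(X,\mathcal{E})$ is the quotient space $X^\sharp/\sim$. The balanced coarse structure of a group. For an infinite group $G$ and an infinite cardinal $\kappa\le|G|$, let $[G]^{<\kappa}$ be the family of subsets of $G$ of cardinality $<\kappa$. $\mathcal{E}_\kappa$ is the coarse structure on $G$ with the base consisting of the sets $\{(x,y):y\in FxF\}$, where $F\in[G]^{<\kappa}$ contains the identity of $G$. The corona of $(G,\mathcal{E}_\kappa)$ is denoted by $\nu_\kappa(G)$. Convergence at infinity. A function $h:(G,\mathcal{E}_\kappa)\to\mathbb{R}$ is convergent at infinity if there is $r\in\mathbb{R}$ such that for every $\varepsilon>0$ one has $|\{g\in G:|h(g)-r|>\varepsilon\}|<\kappa$. *)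

(* Defs.v *)
(* MathComp: the group is a groupType, cardinals are compared with the
   relation #<= of the classical library, the reals are any realType. *)
From HB Require Import structures.
From mathcomp Require Import all_boot all_order all_algebra.
From mathcomp Require Import all_classical reals ereal topology.
Set Implicit Arguments.
Unset Strict Implicit.
Unset Printing Implicit Defensive.
Import Order.TTheory GRing.Theory Num.Theory.
Local Open Scope classical_set_scope.
Local Open Scope card_scope.

Definition card_lt T U (A : set T) (B : set U) : Prop :=
  A #<= B /\ ~ (B #<= A).

Lemma rel_card_le T U (A : set T) (B : set U) (R : T -> U -> Prop) :
    (forall a, A a -> exists2 b, B b & R a b) ->
    (forall a a' b, A a -> A a' -> R a b -> R a' b -> a = a') -> A #<= B.
Proof.
move=> RAB Rinj.
have R' (a : A) : {b : B | R (val a) (val b)}.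
  apply: cid; have [b Bb Rab] := RAB _ (set_mem (valP a)).
  by exists (exist _ b (mem_set Bb)).
apply/card_leP/injfunPex; exists (fun a => sval (R' a)) => //.
move=> a a' _ _ eq_aa'; apply: val_inj.
have Ra' : R (val a') (val (sval (R' a))).
  by rewrite eq_aa'; exact: (svalP (R' a')).
by apply: Rinj (svalP (R' a)) Ra'; exact: set_mem (valP _).
Qed.

Lemma card_le_rel T U (A : set T) (B : set U) : A #<= B ->
  exists R : T -> U -> Prop, [/\ forall a b, R a b -> A a /\ B b,
    forall a, A a -> exists b, R a b,
    forall a b b', R a b -> R a b' -> b = b' &
    forall a a' b, R a b -> R a' b -> a = a'].
Proof.
move=> /card_leP/injfunPex[f _ finj].
exists (fun a b => exists2 x : A, val x = a & val (f x) = b); split.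
- by move=> a b [x <- <-]; split; exact: set_mem (valP _).
- by move=> a /mem_set Aa; exists (val (f (exist _ a Aa))), (exist _ a Aa).
- by move=> a b b' [x <- <-] [y /val_inj -> <-].
- move=> a a' b [x <- <-] [y <- /val_inj/finj->//]; exact: mem_set.
Qed.

Lemma card_le_total T U (A : set T) (B : set U) : A #<= B \/ B #<= A.
Proof.
pose P (R : set (T * U)) := [/\ forall a b, R (a, b) -> A a /\ B b,
  forall a b b', R (a, b) -> R (a, b') -> b = b' &
  forall a a' b, R (a, b) -> R (a', b) -> a = a'].
have [F FP Ftot|R [[RAB Rfun Rinj] Rmax]] := @Zorn_bigcup _ P.
  have both S1 S2 : (\bigcup_(X in F) X) S1 -> (\bigcup_(X in F) X) S2 ->
      exists X, [/\ F X, X S1 & X S2].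
    move=> [X FX X1] [Y FY Y2]; have [XY|YX] := Ftot _ _ FX FY.
      by exists Y; split=> //; exact: XY.
    by exists X; split=> //; exact: YX.
  split.
  - by move=> a b [X /FP[+ _ _]]; apply.
  - by move=> a b b' /both/[apply] -[X [/FP[_ + _] X1 X2]]; apply; eassumption.
  - by move=> a a' b /both/[apply] -[X [/FP[_ _ +] X1 X2]]; apply; eassumption.
have [RA|] := pselect (forall a, A a -> exists b, R (a, b)).
  left; apply: (@rel_card_le _ _ _ _ (fun a b => R (a, b))).
    by move=> a /RA[b Rab]; exists b => //; have [] := RAB _ _ Rab.
  by move=> a a' b _ _; exact: Rinj.
move=> /existsNP[a /not_implyP[Aa nRa]]; right.
apply: (@rel_card_le _ _ _ _ (fun b a => R (a, b))); last first.
  by move=> b b' c _ _; exact: Rfun.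
move=> b Bb; have [[c Rcb]|nRb] := pselect (exists c, R (c, b)).
  by exists c => //; have [] := RAB _ _ Rcb.
exfalso; apply: (Rmax (R `|` [set (a, b)])).
  split; first exact: subsetUl.
  by move=> /(_ (a, b) (or_intror erefl)) Rab; apply: nRa; exists b.
split.
- by move=> c d [/RAB//|[-> ->]].
- move=> c d d' [Rcd|[ca ->]] [Rcd'|[ca' ->]] //; first exact: Rfun Rcd Rcd'.
    by case: nRa; exists d; rewrite -ca'.
  by case: nRa; exists d'; rewrite -ca.
- move=> c c' d [Rcd|[-> db]] [Rcd'|[-> db']] //; first exact: Rinj Rcd Rcd'.
    by case: nRb; exists c; rewrite -db'.
  by case: nRb; exists c'; rewrite -db.
Qed.

Lemma card_le_setX T T' U U' (A : set T) (B : set U) (A' : set T')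
    (B' : set U') :
  A #<= A' -> B #<= B' -> A `*` B #<= A' `*` B'.
Proof.
move=> /card_le_rel[R [RA Rt Rf Ri]] /card_le_rel[S [SA St Sf Si]].
apply: (@rel_card_le _ _ _ _ (fun x y => R x.1 y.1 /\ S x.2 y.2)).
  move=> [a b] [/= /Rt[a' Ra] /St[b' Sb]]; exists (a', b') => //.
  by split; [have [] := RA _ _ Ra|have [] := SA _ _ Sb].
move=> [a b] [c d] [e f] _ _ /= [h1 h2] [h3 h4].
by rewrite (Ri _ _ _ h1 h3) (Si _ _ _ h2 h4).
Qed.

Lemma card_le_setU T U (D E : set T) (C : set U) :
    infinite_set C -> C `*` C #<= C -> D #<= C -> E #<= C -> D `|` E #<= C.
Proof.
move=> /infiniteP Cinf CC /card_le_rel[R [RA Rt Rf Ri]].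
move=> /card_le_rel[S [SA St Sf Si]].
have [N [NA Nt Nf Ni]] := card_le_rel Cinf.
have [[c0 Nc0] [c1 Nc1]] := (Nt 0%N I, Nt 1%N I).
apply: card_le_trans CC.
apply: (@rel_card_le _ _ _ _ (fun x y => (N 0%N y.1 /\ R x y.2) \/
   (N 1%N y.1 /\ S x y.2))).
  move=> x [/Rt[y Rxy]|/St[y Sxy]].
    exists (c0, y); last by left.
    by split; [have [] := NA _ _ Nc0|have [] := RA _ _ Rxy].
  exists (c1, y); last by right.
  by split; [have [] := NA _ _ Nc1|have [] := SA _ _ Sxy].
move=> x x' [c y] _ _ /= [[h1 h2]|[h1 h2]] [[h3 h4]|[h3 h4]].
- exact: Ri h2 h4.
- by have := Ni _ _ _ h1 h3.
- by have := Ni _ _ _ h1 h3.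
- exact: Si h2 h4.
Qed.

(* |C| * |C| <= |C|: a maximal injection D * D -> D, coded by its graph, has
   |C \ D| <= |D|, since otherwise it extends to D `|` E with E a copy of D in
   C \ D. *)
Lemma card_setX_infinite T (C : set T) : infinite_set C -> C `*` C #<= C.
Proof.
move=> Cinf; have /infiniteP/card_le_rel[N [NA Nt Nf Ni]] := Cinf.
pose dom (R : set ((T * T) * T)) := [set a | exists c, R ((a, a), c)].
pose Q R := [/\ forall a b c, R ((a, b), c) ->
      [/\ dom R a, dom R b, dom R c & C a],
  forall a b, dom R a -> dom R b -> exists c, R ((a, b), c) &
  forall p q c, R (p, c) -> R (q, c) -> p = q].
pose R0 : set ((T * T) * T) := [set x | exists m n,
  [/\ N m x.1.1, N n x.1.2 & N (pickle (m, n)) x.2]].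
have dom0 m a : N m a -> dom R0 a.
  move=> Nma; have [c Nc] := Nt (pickle (m, m)) I.
  by exists c, m, m.
have Q0 : Q R0.
  split.
  - move=> a b c [m [n [/= h1 h2 h3]]].
    by have [_ Ca] := NA _ _ h1; split=> //; [exact: dom0 h1|exact: dom0 h2|
      exact: dom0 h3].
  - move=> a b [? [m [? [ma _ _]]]] [? [n [? [nb _ _]]]].
    by have [c Nc] := Nt (pickle (m, n)) I; exists c, m, n.
  - move=> [a b] [a' b'] c [m [n [/= h1 h2 h3]]] [m' [n' [/= h4 h5 h6]]].
    have /(pcan_inj pickleK) [mm nn] := Ni _ _ _ h3 h6.
    move: h4 h5; rewrite -mm -nn => h4 h5.
    by rewrite (Nf _ _ _ h1 h4) (Nf _ _ _ h2 h5).
have domS R R' : R `<=` R' -> dom R `<=` dom R'.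
  by move=> RR' a [c Rc]; exists c; exact: RR'.
have [F FP Ftot|R [QR Rmax]] := @Zorn_bigcup _ (fun R => Q (R `|` R0)).
  set U := _ `|` _.
  have sub X : F X -> (X `|` R0) `<=` U.
    by move=> FX x [Xx|?]; [left; exists X|right].
  have both x y : U x -> U y -> exists Y, [/\ Q Y, Y `<=` U, Y x & Y y].
    move=> [[X FX Xx]|x0] [[Y FY Yy]|y0].
    - have [XY|YX] := Ftot _ _ FX FY.
        exists (Y `|` R0).
        by split; [exact: FP|exact: sub|left; exact: XY|left].
      exists (X `|` R0).
      by split; [exact: FP|exact: sub|left|left; exact: YX].
    - exists (X `|` R0); split=> //; [exact: FP|exact: sub|by left|by right].
    - exists (Y `|` R0); split=> //; [exact: FP|exact: sub|by right|by left].
    - by exists R0; split=> //; exact: subsetUr.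
  split.
  - move=> a b c Uc; have [Y [[Y1 _ _] YU Yc _]] := both _ _ Uc Uc.
    by have [/domS da /domS db /domS dc ?] := Y1 _ _ _ Yc; split; auto.
  - move=> a b [c Uc] [d Ud]; have [Y [[_ Y2 _] YU Yc Yd]] := both _ _ Uc Ud.
    have [|e Ye] := Y2 a b (ex_intro _ _ Yc); first by exists d.
    by exists e; exact: YU.
  - move=> p q c Up Uq; have [Y [[_ _ Y3] _ Yp Yq]] := both _ _ Up Uq.
    exact: Y3 Yp Yq.
set M := R `|` R0 in QR; have [Q1 Q2 Q3] := QR.
pose D := dom M.
have DC : D `<=` C by move=> a [c Mc]; have [] := Q1 _ _ _ Mc.
have DD : D `*` D #<= D.
  apply: (@rel_card_le _ _ _ _ (fun p c => M (p, c))).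
    move=> [a b] [/= Da Db]; have [c Mc] := Q2 _ _ Da Db.
    by exists c => //; have [] := Q1 _ _ _ Mc.
  by move=> p q c _ _; exact: Q3.
have Dinf : infinite_set D.
  apply/infiniteP; apply: (@rel_card_le _ _ _ _ N).
    move=> n _; have [b Nb] := Nt n I; exists b => //.
    by apply: domS (dom0 _ _ Nb); exact: subsetUr.
  by move=> m n b _ _; exact: Ni.
have [CD|DCD] := card_le_total (C `\` D) D.
  have CleD : C #<= D.
    rewrite -(setDUK DC); exact: card_le_setU.
  apply: card_le_trans (card_le_setX CleD CleD) _.
  by apply: card_le_trans DD _; exact: subset_card_le.
have [g [gA gt gf gi]] := card_le_rel DCD.
pose E := [set b | exists a, g a b].
have EC b : E b -> (C `\` D) b by move=> [a /gA[]].
have DE : D #<= E.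
  apply: (@rel_card_le _ _ _ _ g) => [a /gt[b gab]|a a' b _ _]; last exact: gi.
  by exists b => //; exists a.
have ED : E #<= D.
  apply: (@rel_card_le _ _ _ _ (fun b a => g a b)).
    by move=> b [a gab]; exists a => //; have [] := gA _ _ gab.
  by move=> b b' a _ _; exact: gf.
have UD : D `|` E #<= D by exact: card_le_setU.
have : (D `|` E) `*` (D `|` E) #<= E.
  apply: card_le_trans (card_le_setX UD UD) _.
  exact: card_le_trans DD DE.
move=> /card_le_rel[h [hA ht hf hi]].
pose M' : set ((T * T) * T) := M `|`
  [set x | h x.1 x.2 /\ ~ (D x.1.1 /\ D x.1.2)].
have dM' a : (D `|` E) a -> dom M' a.
  move=> UDa; have [[c Mc]|nDa] := pselect (D a); first by exists c; left.
  have [c hc] := ht (a, a) (conj UDa UDa).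
  by exists c; right; split=> // -[].
have dM'E a : dom M' a -> (D `|` E) a.
  move=> [c [Mc|[/hA[[] //]]]]; by left; exists c.
exfalso; apply: (Rmax M').
  split; first by move=> x Rx; left; left.
  have [a Da] := infinite_setN0 Dinf; have [b gab] := gt _ Da.
  have Eb : E b by exists a.
  have [_ nDb] := EC _ Eb.
  have [c hc] := ht (b, b) (conj (or_intror Eb) (or_intror Eb)).
  have M'c : M' ((b, b), c) by right; split=> //= -[].
  by move=> /(_ _ M'c) Rc; apply: nDb; exists c; left.
rewrite (_ : _ `|` _ = M'); last first.
  by apply/setUidPl => x R0x; left; right.
have ME p c : M (p, c) -> D c by case: p => a b /Q1[].
split.
- move=> a b c [/Q1[Da Db Dc Ca]|[/= /hA[[/= Ua Ub] Ec] _]].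
    by split=> //; apply: dM'; left.
  split; [exact: dM'|exact: dM'|by apply: dM'; right|].
  by case: Ua => [/DC//|/EC[]].
- move=> a b /dM'E Ua /dM'E Ub.
  have [[Da Db]|nD] := pselect (D a /\ D b).
    by have [c Mc] := Q2 _ _ Da Db; exists c; left.
  by have [c hc] := ht (a, b) (conj Ua Ub); exists c; right.
- move=> p q c [Mp|[hp _]] [Mq|[hq _]].
  + exact: Q3 Mp Mq.
  + by have [_ /EC[_]] := hA _ _ hq; case; exact: ME Mp.
  + by have [_ /EC[_]] := hA _ _ hp; case; exact: ME Mq.
  + exact: hi hp hq.
Qed.

Lemma card_lt_finite T U (A : set T) (K : set U) :
  infinite_set K -> finite_set A -> card_lt A K.
Proof.
move=> Kinf Afin; have nKA : ~ (K #<= A).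
  move=> KA; apply: Kinf; have /finite_set_leP[n An] := Afin.
  by apply/finite_set_leP; exists n; exact: card_le_trans KA An.
by split=> //; have [] := card_le_total A K.
Qed.

Lemma card_le_lt T U V (A : set T) (B : set U) (K : set V) :
  A #<= B -> card_lt B K -> card_lt A K.
Proof.
move=> AB [BK nKB]; split; first exact: card_le_trans AB BK.
by move=> KA; apply: nKB; exact: card_le_trans KA AB.
Qed.

Lemma card_lt_setX T U V (A : set T) (B : set U) (K : set V) :
  infinite_set K -> card_lt A K -> card_lt B K -> card_lt (A `*` B) K.
Proof.
move=> Kinf.
have key W (C : set W) : A #<= C -> B #<= C -> card_lt C K ->
    card_lt (A `*` B) K.
  move=> leAC leBC CK; apply: card_le_lt (card_le_setX leAC leBC) _.
  have [Cfin|Cinf] := pselect (finite_set C).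
    by apply: card_lt_finite => //; exact: finite_setX.
  exact: card_le_lt (card_setX_infinite Cinf) CK.
move=> AK BK; have [leAB|leBA] := card_le_total A B.
  exact: key BK.
exact: key AK.
Qed.

Local Open Scope relation_scope.

(* The library's [B \; A] is "first A, then B", so that [E' \; E] is
   {(x, y) | exists z, (x, z) \in E and (z, y) \in E'}. *)
Record coarse_structure (X : Type) := CoarseStructure {
  entourages : set (set (X * X));
  entourage_diagonal : forall E, entourages E -> diagonal `<=` E;
  entourage_comp : forall E E', entourages E -> entourages E' ->
    entourages (E' \; E);
  entourage_inv : forall E, entourages E -> entourages E^-1;
  entourage_sub : forall E E', entourages E ->
    diagonal `<=` E' -> E' `<=` E -> entourages E';
  entourage_connected : forall x y, exists2 E, entourages E & E (x, y)
}.

Definition entourage_base (X : Type) (E : coarse_structure X)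
    (B : set (set (X * X))) : Prop :=
  B `<=` entourages E /\ forall V, entourages E V -> exists2 W, B W & V `<=` W.

(* E[x] is the library's [xsection E x]. *)
Definition entourage_image (X : Type) (V : set (X * X)) (A : set X) : set X :=
  \bigcup_(a in A) xsection V a.

Definition coarse_bounded (X : Type) (E : coarse_structure X)
    (B : set X) : Prop :=
  exists V a, entourages E V /\ B `<=` xsection V a.

(* Valued in [\bar R]: a set that is not bounded has diameter +oo. *)
Definition diam (R : realType) (A : set R) : \bar R :=
  ereal_sup [set (`|p.1 - p.2|%R)%:E | p in A `*` A].

Definition slowly_oscillating (R : realType) (X : Type)
    (E : coarse_structure X) (f : X -> R) : Prop :=
  forall (V : set (X * X)) (e : R), entourages E V -> (0 < e)%R ->
    exists2 B, coarse_bounded E B &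
      forall x, ~ B x -> (diam (f @` xsection V x) < e%:E)%E.

(* Stone-Cech compactification of the discrete space X. *)
Definition stone_cech (X : Type) : Type := {q : set_system X | UltraFilter q}.

Section StoneCech.
Variable X : Type.

Definition stone_cech_basic (A : set X) : set (stone_cech X) :=
  [set q | sval q A].

HB.instance Definition _ := gen_eqMixin (stone_cech X).
HB.instance Definition _ := gen_choiceMixin (stone_cech X).

Lemma stone_cech_basic_cover :
  \bigcup_(A in [set: set X]) stone_cech_basic A = setT.
Proof.
apply/seteqP; split=> // -[q uq] _; exists setT => //; exact: filterT.
Qed.

Lemma stone_cech_basic_join (A B : set X) (q : stone_cech X) :
  [set: set X] A -> [set: set X] B ->
  stone_cech_basic A q -> stone_cech_basic B q ->
  exists C, [/\ [set: set X] C, stone_cech_basic C q &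
    stone_cech_basic C `<=` stone_cech_basic A `&` stone_cech_basic B].
Proof.
move=> _ _ qA qB; exists (A `&` B); split=> //.
  by case: q qA qB => q uq; exact: filterI.
move=> [r ur] rAB; rewrite /stone_cech_basic /=; split.
  by apply: filterS rAB; exact: subIsetl.
by apply: filterS rAB; exact: subIsetr.
Qed.

HB.instance Definition _ :=
  isBaseTopological.Build (stone_cech X)
    stone_cech_basic_cover stone_cech_basic_join.

End StoneCech.

Section Corona.
Variables (X : Type) (E : coarse_structure X).

(* X^sharp; as a type it carries the subspace topology. *)
Definition sharp : set (stone_cech X) :=
  [set q | forall A, sval q A -> ~ coarse_bounded E A].

Definition parallel : set (sharp * sharp) :=
  [set rq | exists2 V, entourages E V &
    forall A, sval (val rq.1) A -> sval (val rq.2) (entourage_image V A)].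

Definition is_equivalence (S : set (sharp * sharp)) : Prop :=
  [/\ diagonal `<=` S, S^-1 `<=` S & S \; S `<=` S].

(* The intersection of all closed equivalence relations containing
   [parallel]; it is the smallest one by [corona_relP]. *)
Definition corona_rel : set (sharp * sharp) :=
  \bigcap_(S in [set S | [/\ is_equivalence S, closed S & parallel `<=` S]]) S.

Lemma corona_relP :
  [/\ is_equivalence corona_rel, closed corona_rel, parallel `<=` corona_rel &
    forall S, is_equivalence S -> closed S -> parallel `<=` S ->
      corona_rel `<=` S].
Proof.
split.
- split.
  + by move=> p pp S [[Srefl _ _] _ _]; exact: Srefl.
  + move=> p pp S SP; have [[_ Ssym _] _ _] := SP.
    by apply: Ssym; exact: (pp S SP).
  + move=> p [q pq qp] S SP; have [[_ _ Str] _ _] := SP; apply: Str.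
    by exists q; [exact: (pq S SP)|exact: (qp S SP)].
- by apply: closed_bigI => S [].
- by move=> p pp S [_ _ pS]; exact: pS.
- by move=> S S1 S2 S3 p; apply.
Qed.

Definition corona_relb : rel sharp := fun p q => `[< corona_rel (p, q) >].

Lemma corona_relb_refl : reflexive corona_relb.
Proof.
have [[h _ _] _ _ _] := corona_relP.
by move=> p; apply/asboolP; exact: (h (p, p) erefl).
Qed.

Lemma corona_relb_sym : symmetric corona_relb.
Proof.
have [[_ h _] _ _ _] := corona_relP.
by move=> p q; apply/idP/idP => /asboolP pq; apply/asboolP; exact: (h (_, _)).
Qed.

Lemma corona_relb_trans : transitive corona_relb.
Proof.
have [[_ _ h] _ _ _] := corona_relP.
move=> q p r /asboolP pq /asboolP qr; apply/asboolP.
by apply: (h (_, _)); exists q.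
Qed.

Canonical corona_equiv :=
  EquivRel corona_relb corona_relb_refl corona_relb_sym corona_relb_trans.

Definition corona : topologicalType :=
  quotient_topology {eq_quot corona_equiv}%qT.

End Corona.

Local Open Scope group_scope.

(* The cardinal kappa is given as the cardinality of a type K. *)
Section Balanced.
Variables (G : groupType) (K : Type).

Definition balanced_base_set (F : set G) : set (G * G) :=
  [set xy | exists f g, [/\ F f, F g & xy.2 = f * xy.1 * g]].

Definition balanced_base : set (set (G * G)) :=
  [set balanced_base_set F | F in [set F | card_lt F [set: K] /\ F 1]].

Definition balanced_family : set (set (G * G)) :=
  [set V | diagonal `<=` V /\ exists2 W, balanced_base W & V `<=` W].

Lemma balanced_base_set_diagonal F : F 1 -> diagonal `<=` balanced_base_set F.
Proof.
move=> F1 [x y] xy; have {y xy}<- : x = y by [].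
by exists 1, 1; rewrite mul1g mulg1.
Qed.

Lemma balanced_family_diagonal V : balanced_family V -> diagonal `<=` V.
Proof. by case. Qed.

Lemma balanced_family_comp V V' : infinite_set [set: K] ->
  balanced_family V -> balanced_family V' -> balanced_family (V' \; V).
Proof.
move=> Kinf [dV [_ [F [FK F1] <-] VF]] [dV' [_ [F' [F'K F'1] <-] V'F']].
split; first by move=> [x y] xy; exists x; [exact: dV|exact: dV'].
pose m (t : (G * G) * (G * G)) := t.1.1 * t.1.2 * (t.2.1 * t.2.2).
pose H := m @` ((F' `*` F) `*` (F `*` F')).
exists (balanced_base_set H).
  exists H => //; split; last first.
    by exists ((1, 1), (1, 1)) => //; rewrite /m /= !mulg1.
  apply: card_le_lt (card_image_le _ _) _.
  by apply: card_lt_setX => //; exact: card_lt_setX.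
move=> [x y] [z /VF[f [g [/= Ff Fg ->]]] /V'F'[f' [g' [/= Ff' Fg' ->]]]].
exists (f' * f), (g * g'); split; last by rewrite /= !mulgA.
  by exists ((f', f), (1, 1)) => //; rewrite /m /= !mulg1.
by exists ((1, 1), (g, g')) => //; rewrite /m /= !mul1g.
Qed.

Lemma balanced_family_inv V :
  balanced_family V -> balanced_family (V^-1)%relation.
Proof.
move=> [dV [_ [F [FK F1] <-] VF]]; split.
  by move=> [x y] xy; have {x xy}-> : x = y by []; exact: dV.
exists (balanced_base_set ((fun x : G => x^-1%g) @` F)).
  exists ((fun x : G => x^-1%g) @` F) => //.
  split; last by exists 1; rewrite ?invg1.
  exact: card_le_lt (card_image_le _ _) FK.
move=> [x y] /VF[f [g [/= Ff Fg ->]]].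
exists f^-1%g, g^-1%g; split; [by exists f|by exists g|].
by rewrite /= !mulgA mulVg mul1g mulgK.
Qed.

Lemma balanced_family_sub V V' : balanced_family V ->
  diagonal `<=` V' -> V' `<=` V -> balanced_family V'.
Proof.
move=> [_ [W BW VW]] dV' VV'; split=> //.
by exists W => //; exact: subset_trans VW.
Qed.

Lemma balanced_baseW W : balanced_base W -> balanced_family W.
Proof.
move=> BW; split; last by exists W.
by have [F [_ F1] <-] := BW; exact: balanced_base_set_diagonal.
Qed.

Lemma balanced_family_connected x y : infinite_set [set: K] ->
  exists2 V, balanced_family V & V (x, y).
Proof.
move=> Kinf; exists (balanced_base_set [set 1; x^-1%g * y]).
  apply: balanced_baseW; exists [set 1; x^-1%g * y] => //; split; last by left.
  by apply: card_lt_finite => //; exact: finite_set2.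
by exists 1, (x^-1%g * y); split; [left|right|rewrite /= mul1g mulVKg].
Qed.

Definition balanced_coarse (Kinf : infinite_set [set: K]) :
    coarse_structure G :=
  CoarseStructure balanced_family_diagonal
    (fun V V' => @balanced_family_comp V V' Kinf) balanced_family_inv
    balanced_family_sub (fun x y => balanced_family_connected x y Kinf).

Lemma balanced_coarse_base (Kinf : infinite_set [set: K]) :
  entourage_base (balanced_coarse Kinf) balanced_base.
Proof. by split=> [W|V []] //; exact: balanced_baseW. Qed.

Definition convergent_at_infinity (R : realType) (h : G -> R) : Prop :=
  exists r : R, forall e : R, (0 < e)%R ->
    card_lt [set g | (e < `|h g - r|)%R] [set: K].

End Balanced.

(* Main.v *)
(* Say that B is an asymptotic neighborhood of A if V[A] \ B is bounded for
   every entourage V. Both claims reduce to one fact about (G, E_kappa) with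
   kappa < |G|: along a chain A 0, ..., A 4 of asymptotic neighborhoods, A 0 or
   the complement of A 4 has fewer than kappa elements.
   For a slowly oscillating h the sublevel sets {h < a + n e} form such a
   chain, so {h < a} or {h >= b} is small whenever a < b, and h converges to
   the supremum of the a for which {h < a} is small.
   For the corona, if a closed equivalence S containing the parallelism misses
   (p, q), compactness of X^sharp yields clopen sets given by A 0, A 1, ...,
   with A 0 in p, none of them meeting the S-class of q, each A n.+1 containing
   the S-saturation of A n. These form such a chain, while A 0 belongs to p and
   the complement of A 4 belongs to q, so both are unbounded. *)
Require Import Defs.
From HB Require Import structures.
From mathcomp Require Import all_boot all_order all_algebra.
From mathcomp Require Import all_classical reals ereal topology.
From mathcomp Require Import lra.
Local Open Scope classical_set_scope.

(** * Bounded sets and ultrafilters in a general coarse space *)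

Section CoarseSpace.
Set Implicit Arguments.
Unset Strict Implicit.
Import Order.TTheory Num.Theory.
Variables (X : Type) (E : coarse_structure X).
Local Notation bounded := (coarse_bounded E).
Local Open Scope relation_scope.

Definition asymptotic_nbhd (A B : set X) : Prop :=
  forall V, entourages E V -> bounded (entourage_image V A `\` B).

Lemma coarse_boundedS (A B : set X) : A `<=` B -> bounded B -> bounded A.
Proof.
by move=> AB [V [a [EV BV]]]; exists V, a; split=> //; exact: subset_trans BV.
Qed.

Lemma coarse_bounded0 (x : X) : bounded set0.
Proof. by have [V EV _] := entourage_connected E x x; exists V, x; split. Qed.

Lemma coarse_bounded_image V B : entourages E V -> bounded B ->
  bounded (entourage_image V B).
Proof.
move=> EV [W [a [EW BW]]]; exists (V \; W), a; split.
  exact: entourage_comp.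
move=> y [b Bb /xsectionP Vby]; apply/xsectionP; exists b => //.
exact/xsectionP/BW.
Qed.

(** An entourage joining the two centers encloses both balls in one. *)
Lemma coarse_boundedU (A B : set X) : bounded A -> bounded B ->
  bounded (A `|` B).
Proof.
move=> [V [a [EV AV]]] [W [b [EW BW]]].
have [U EU Uab] := entourage_connected E a b.
exists (W \; (U \; V)), a; split.
  by apply: entourage_comp => //; exact: entourage_comp.
have dg Z z : entourages E Z -> Z (z, z).
  by move=> /entourage_diagonal; apply.
move=> y [/AV/xsectionP Vy|/BW/xsectionP Wy]; apply/xsectionP.
  by exists y; [exists y => //|]; exact: dg.
by exists b => //; exists a => //; exact: dg.
Qed.

(** If h x < a and b <= h y with y in V[x], then h(V[x]) has diameter at least b - a, since x itself
    is in V[x]. So x lies in the bounded exceptional set [B], and y in V[B]. *)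
Lemma slowly_oscillating_nbhd (R : realType) (h : X -> R) (a b : R) :
    slowly_oscillating E h -> (a < b)%R ->
  asymptotic_nbhd [set x | (h x < a)%R] [set x | (h x < b)%R].
Proof.
move=> hso ab V EV; have [|B bB hB] := hso V (b - a)%R EV.
  by rewrite subr_gt0.
apply: coarse_boundedS (coarse_bounded_image EV bB).
move=> y [[x /= hxa Vxy] /negP]; rewrite -leNgt => hyb.
exists x => //; apply: contrapT => /hB; apply/negP.
rewrite -leNgt.
apply: (@le_trans _ _ (`|h y - h x|%R)%:E).
  rewrite lee_fin; apply: le_trans (ler_norm _).
  by lra.
apply: ereal_sup_ubound; exists (h y, h x) => //; split; first by exists y.
by exists x => //; apply/xsectionP; exact: entourage_diagonal EV _ _.
Qed.

Lemma sharp_ultra (q : sharp E) : UltraFilter (sval (val q)).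
Proof. exact: (svalP (val q)). Qed.

Lemma sharpT (q : sharp E) : sval (val q) setT.
Proof. by have uq := sharp_ultra q; exact: filterT. Qed.

Lemma sharpP (q : sharp E) A : sval (val q) A -> ~ bounded A.
Proof. by case: q => q qs; apply: (set_mem qs). Qed.

Lemma sharp_extend (F : set_system X) : ProperFilter F ->
    (forall B, bounded B -> F (~` B)) ->
  exists q : sharp E, F `<=` sval (val q).
Proof.
move=> FF Fb; have [q [uq Fq]] := ultraFilterLemma FF.
have qs : sharp E (exist _ q uq).
  move=> A /= qA /Fb/Fq qnA.
  have : q (A `&` ~` A) by exact: filterI.
  by rewrite setICr; exact: filter_not_empty.
by exists (SigSub (mem_set qs)).
Qed.

(** The sets containing [D] up to a bounded set form a filter, proper because [D] is unbounded. The
    point [x] makes the empty set bounded. *)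
Lemma sharp_unbounded (x : X) (D : set X) : ~ bounded D ->
  exists q : sharp E, sval (val q) D.
Proof.
move=> Dub; pose F : set_system X := [set A | bounded (D `\` A)].
have [||q Fq] := @sharp_extend F; last first.
- by exists q; apply: Fq; rewrite /F /= setDv; exact: coarse_bounded0.
- by move=> B; apply: coarse_boundedS => y [_ /contrapT].
apply: Build_ProperFilter; first by rewrite /F /= setD0.
split; rewrite /F /=.
- by rewrite setDT; exact: coarse_bounded0.
- move=> A B FA FB; rewrite /= setDIr; exact: coarse_boundedU.
- by move=> A B AB; apply: coarse_boundedS; exact: setDS.
Qed.

Lemma sharp_setC (q : sharp E) A : ~ sval (val q) A <-> sval (val q) (~` A).
Proof.
have uq := sharp_ultra q; split=> [nA|nA qA].
  by have [] := in_ultra_setVsetC A uq.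
have : sval (val q) (A `&` ~` A) by exact: filterI.
by rewrite setICr; exact: filter_not_empty.
Qed.

(* A selection D -> A along V pushes an ultrafilter containing the unbounded
   set D = V[A] \ B forward to a parallel one containing A. *)
Lemma parallel_unbounded (x : X) (V : set (X * X)) (A B : set X) :
  entourages E V -> ~ bounded (entourage_image V A `\` B) ->
  exists p q : sharp E,
    [/\ parallel (p, q), sval (val p) A & sval (val q) (~` B)].
Proof.
move=> EV /(sharp_unbounded x)[q qD].
set D := _ `\` _ in qD.
have [f fP] : exists f : X -> X, forall y, D y -> A (f y) /\ V (f y, y).
  suff /choice[f fP] : forall y, exists z, D y -> A z /\ V (z, y) by exists f.
  move=> y; have [[[a Aa /xsectionP Vay] _]|] := pselect (D y).
    by exists a.
  by exists x.
have uq := sharp_ultra q.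
pose p : set_system X := [set R | sval (val q) (f @^-1` R)].
have img R : p R -> sval (val q) (entourage_image V R).
  move=> pR; apply: filterS (filterI qD pR) => y [/fP[_ Vy] Rfy].
  by exists (f y) => //; exact/xsectionP.
have [|r pr] := @sharp_extend p.
  move=> R bR; apply/sharp_setC => pR.
  by apply: (sharpP (img _ pR)); exact: coarse_bounded_image.
exists r, q; split.
- exists V => // R rR; apply: img; apply: contrapT => /sharp_setC pCR.
  by have /sharp_setC := pr (~` R) pCR; apply.
- by apply: pr; apply: filterS qD => y /fP[].
- by apply: filterS qD => y [].
Qed.

Lemma closed_sharpP (S : set (sharp E * sharp E)) (p q : sharp E) :
  closed S -> ~ S (p, q) -> exists A B, [/\ sval (val p) A, sval (val q) B &
    forall a b : sharp E, sval (val a) A -> sval (val b) B -> ~ S (a, b)].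
Proof.
rewrite closedE => clS nS; have : nbhs (p, q) (~` S).
  by apply: contrapT => ?; apply: nS; exact: clS.
have basic (r : sharp E) (U : set (sharp E)) : nbhs r U ->
    exists2 A, sval (val r) A & forall s : sharp E, sval (val s) A -> U s.
  move=> [_ [[W oW <-] /= Wr WU]].
  have [F _ FW] := oW; move: Wr; rewrite -FW => -[A FA rA]; exists A => // s sA.
  by apply: WU; rewrite /= -FW; exists A.
move=> [[U W] [/= /basic[A pA AU] /basic[B qB BW]] UWS].
by exists A, B; split=> // a b aA bB; apply: (UWS (a, b));
  split; [exact: AU|exact: BW].
Qed.

(** * Closed equivalence relations on X^sharp containing the parallelism *)

Section ClosedEquivalence.
Variable S : set (sharp E * sharp E).
Hypotheses (Seq : is_equivalence S) (Scl : closed S)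
  (Spar : @parallel X E `<=` S).

Let Strans a b c : S (a, b) -> S (b, c) -> S (a, c).
Proof. by have [_ _ tr] := Seq; move=> ab bc; apply: tr; exists b. Qed.

(* The saturation of a clopen subset of X^sharp is closed: X^sharp is
   compact. *)
Lemma closed_saturation A t :
    (forall D, sval (val t) D ->
       exists a d, [/\ S (a, d), sval (val a) A & sval (val d) D]) ->
  exists2 a, S (a, t) & sval (val a) A.
Proof.
move=> At; have ut := sharp_ultra t.
(* A point of X^sharp above [F] is a cluster point of points a of [A] related to some d, as d tends
   to [t]; closedness of [S] then relates it to [t]. *)
pose F : set_system X := [set M | exists2 D, sval (val t) D &
  forall a d, S (a, d) -> sval (val a) A -> sval (val d) D -> sval (val a) M].
have FF : ProperFilter F.
  apply: Build_ProperFilter.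
    move=> [D /At[a [d [Sad aA dD]]] /(_ _ _ Sad aA dD)].
    by have ua := sharp_ultra a; exact: filter_not_empty.
  split.
  - exists setT; first exact: filterT.
    by move=> a d _ _ _; have ua := sharp_ultra a; exact: filterT.
  - move=> M N [D tD DM] [D' tD' DN]; exists (D `&` D'); first exact: filterI.
    move=> a d Sad aA dD; have ua := sharp_ultra a; have ud := sharp_ultra d.
    apply: filterI.
      by apply: DM Sad aA _; apply: filterS dD => ? [].
    by apply: DN Sad aA _; apply: filterS dD => ? [].
  - move=> M N MN [D tD DM]; exists D => // a d Sad aA dD.
    by have ua := sharp_ultra a; apply: filterS MN (DM _ _ Sad aA dD).
have [|a Fa] := sharp_extend FF.
  move=> B bB; exists setT; first exact: filterT.
  by move=> a d _ _ _; apply/sharp_setC => aB; exact: sharpP aB bB.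
exists a; last by apply: Fa; exists setT => //; exact: filterT.
apply: contrapT => /(closed_sharpP Scl)[M [D [aM tD MD]]].
have /Fa/sharp_setC : F (~` M); last by apply.
exists D => // a' d' Sad _ dD; apply/sharp_setC => aM'.
exact: MD aM' dD Sad.
Qed.

(** The saturation of [A] and the class of [q] are disjoint closed sets in a compact space. If no
    clopen set separated them, the intersections of their clopen neighborhoods would generate a
    proper filter; a point above it would be related both to [q] and to a point of [A]. *)
Lemma closed_equivalence_separation A q :
    (forall a, sval (val a) A -> ~ S (a, q)) ->
  exists B, (forall a b, sval (val a) A -> S (a, b) -> sval (val b) B) /\
    forall b, sval (val b) B -> ~ S (b, q).
Proof.
move=> Aq; apply: contrapT => noB.
pose F : set_system X := [set C | exists B D, [/\
  forall a b, sval (val a) A -> S (a, b) -> sval (val b) B,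
  forall b, S (b, q) -> sval (val b) D & B `&` D `<=` C]].
have FF : ProperFilter F.
  apply: Build_ProperFilter.
    move=> [B [D [AB qD BD0]]]; apply: noB; exists B; split=> // b bB /qD bD.
    have ub := sharp_ultra b.
    by apply: (@filter_not_empty _ (sval (val b))); apply: filterS BD0 _;
      exact: filterI.
  split.
  - by exists setT, setT; split=> // *; exact: sharpT.
  - move=> C C' [B [D [AB qD BD]]] [B' [D' [AB' qD' BD']]].
    exists (B `&` B'), (D `&` D'); split.
    + move=> a b aA Sab; have ub := sharp_ultra b; apply: filterI.
        exact: AB aA Sab.
      exact: AB' aA Sab.
    + by move=> b Sbq; have ub := sharp_ultra b; apply: filterI; auto.
    + by move=> x [[Bx B'x] [Dx D'x]]; split; [exact: BD|exact: BD'].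
  - move=> C C' CC' [B [D [AB qD BD]]]; exists B, D; split=> //.
    exact: subset_trans CC'.
have [|t Ft] := sharp_extend FF.
  move=> B bB; exists (~` B), setT; split=> [a b _ _|b _|x []//].
    by apply/sharp_setC => aB; exact: sharpP aB bB.
  exact: sharpT.
have Stq : S (t, q).
  apply: contrapT => /(closed_sharpP Scl)[D [Q [tD qQ DQ]]].
  have /Ft/sharp_setC : F (~` D); last by apply.
  exists setT, (~` D); split=> [a b _ _|b Sbq|x []//].
    exact: sharpT.
  by apply/sharp_setC => bD; exact: DQ bD qQ Sbq.
have [|a Sat aA] := @closed_saturation A t.
  move=> D tD; apply: contrapT => nD.
  have /Ft/sharp_setC : F (~` D); last by apply.
  exists (~` D), setT; split=> [a b aA Sab|b _|x []//].
    by apply/sharp_setC => bD; apply: nD; exists a, b.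
  exact: sharpT.
exact: Aq aA (Strans Sat Stq).
Qed.

Lemma closed_equivalence_chain (x : X) (p q : sharp E) : ~ S (p, q) ->
  exists A : nat -> set X, [/\ sval (val p) (A 0),
    forall n, asymptotic_nbhd (A n) (A n.+1) &
    forall n, sval (val q) (~` A n)].
Proof.
have [Srefl _ _] := Seq.
move=> /(closed_sharpP Scl)[A0 [Q [pA0 qQ AQ]]].
pose P A := forall a, sval (val a) A -> ~ S (a, q).
have /choice[next nextP] A : exists B, P A -> P B /\ asymptotic_nbhd A B.
  have [/closed_equivalence_separation[B [AB Bq]]|] := pselect (P A).
    (* An unbounded V[A] \ B would give parallel, hence [S]-related, points: one containing [A], the
       other not containing [B]. *)
    exists B => _; split=> // V EV; apply: contrapT.
    move=> /(parallel_unbounded x EV)[a [b [/Spar Sab aA]]].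
    by move=> /sharp_setC; apply; exact: AB Sab.
  (* Default value of [next] outside [P], never reached from [A0]. *)
  by exists A.
have PA n : P (iter n next A0).
  elim: n => [a aA|n /nextP[]//]; exact: AQ.
exists (fun n => iter n next A0); split=> // n.
  by have [] := nextP _ (PA n).
by apply/sharp_setC => /PA; apply; exact: Srefl.
Qed.

End ClosedEquivalence.

End CoarseSpace.

(** * Cardinality and asymptotic neighborhoods in (G, E_kappa) *)

Section BalancedGroup.
Set Implicit Arguments.
Unset Strict Implicit.
Local Open Scope card_scope.

(** A point of the union is coded by an index and its code within that piece; then kappa * kappa <=
    kappa. *)
Lemma card_le_bigcup I T U (D : set I) (A : I -> set T) (K : set U) :
    infinite_set K -> D #<= K -> (forall i, D i -> A i #<= K) ->
  \bigcup_(i in D) A i #<= K.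
Proof.
move=> Kinf DK AK.
have /choice[f fP] (i : I) : exists f : T -> U -> Prop, D i ->
    (forall x, A i x -> exists2 k, K k & f x k) /\
    (forall x y k, f x k -> f y k -> x = y).
  have [Di|nDi] := pselect (D i); last by exists (fun _ _ => True).
  have [f [fK ft _ fi]] := card_le_rel (AK _ Di); exists f => _; split=> //.
  by move=> x /ft[k fxk]; exists k => //; have [] := fK _ _ fxk.
apply: card_le_trans (card_setX_infinite Kinf).
apply: card_le_trans (card_le_setX DK (card_lexx K)).
apply: (@rel_card_le _ _ _ _ (fun x ik => D ik.1 /\ f ik.1 x ik.2)).
  move=> x [i Di Aix]; have [/(_ _ Aix)[k Kk fxk] _] := fP i Di.
  by exists (i, k).
move=> x y [i k] _ _ /= [Di fx] [_ fy].
by have [_ fi] := fP i Di; exact: fi fx fy.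
Qed.

Variables (G : groupType) (K : Type) (Kinf : infinite_set [set: K]).
Local Notation E := (balanced_coarse G Kinf).
Local Open Scope group_scope.

(** The ball F a F is an image of F x F. Conversely, a nonempty [B] containing b is b F with F =
    b^-1 B, which contains 1. *)
Lemma balanced_boundedP (B : set G) :
  coarse_bounded E B <-> card_lt B [set: K].
Proof.
split=> [[V [a [[_ [_ [F [FK F1] <-] VF]] BV]]]|BK].
  apply: card_le_lt (card_lt_setX Kinf FK FK).
  apply: card_le_trans (card_image_le (fun t => t.1 * a * t.2) _).
  apply: subset_card_le => y /BV/xsectionP/VF[f [g [/= Ff Fg ->]]].
  by exists (f, g).
have [->|/set0P[b Bb]] := eqVneq B set0; first exact: coarse_bounded0 1.
pose F := (fun x => b^-1 * x) @` B.
have F1 : F 1 by exists b; rewrite ?mulVg.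
exists (balanced_base_set F), b; split.
  apply: balanced_baseW; exists F => //; split=> //.
  exact: card_le_lt (card_image_le _ _) BK.
move=> x Bx; apply/xsectionP; exists 1, (b^-1 * x); split=> //=.
  by exists x.
by rewrite mul1g mulVKg.
Qed.

(** As c x d = (c a^-1) (a x b) (b^-1 d), a finite [F] yields an entourage taking each a x b to c x
    d, and x is recovered from c x d. *)
Lemma asymptotic_nbhd_translates (A B : set G) (a b c d : G) :
    asymptotic_nbhd E A B ->
  card_lt [set x | A (a * x * b) /\ ~ B (c * x * d)] [set: K].
Proof.
move=> AB; pose F := [set 1; c * a^-1; b^-1 * d].
have EF : entourages E (balanced_base_set F).
  apply: balanced_baseW; exists F => //; split; last by left; left.
  apply: card_lt_finite => //; rewrite !finite_setU.
  by do ![split]; exact: finite_set1.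
have /balanced_boundedP ABK := AB _ EF.
apply: card_le_lt ABK.
apply: (@rel_card_le _ _ _ _ (fun x y => y = c * x * d)).
  move=> x [Ax nBx]; exists (c * x * d) => //; split=> //.
  exists (a * x * b) => //; apply/xsectionP.
  exists (c * a^-1), (b^-1 * d); split; [by left; right|by right|].
  by rewrite /= !mulgA mulgVK mulgK.
by move=> x y _ _ _ -> /mulIg/mulgI.
Qed.

Lemma card_lt_notin (f : K -> G) (B : set G) :
  injective f -> card_lt B [set: K] -> exists k, ~ B (f k).
Proof.
move=> finj [_ KB]; apply: contrapT => /forallNP fB; apply: KB.
apply: (@rel_card_le _ _ _ _ (fun k x => x = f k)).
  by move=> k _; exists (f k) => //; exact: contrapT (fB k).
by move=> k k' x _ _ -> /finj.
Qed.

Lemma not_card_lt_inj (A : set G) : ~ card_lt A [set: K] ->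
  exists2 f : K -> G, injective f & forall k, A (f k).
Proof.
move=> AK; have /card_leP/injfunPex[f _ finj] : [set: K] #<= A.
  apply: contrapT => KA; apply: AK; split=> //.
  by have [] := card_le_total A [set: K].
pose toK (k : K) : [set: K] := SigSub (mem_set (I : [set: K] k)).
exists (fun k => val (f (toK k))) => [k k' /val_inj/finj|k].
  by move=> /(_ (mem_set I) (mem_set I)) [].
exact: set_mem (valP _).
Qed.

(* Choose kappa many points g in A 0 and kappa many g' outside A 4. As
   kappa < |G|, some x avoids all the exceptional sets of left multiplication
   by g^-1 and by g'; the exceptional sets of right multiplication by x and
   x^-1 then miss some g and some g', so that g, g * x, x, g' * x, g' lie
   successively in A 0, ..., A 4. *)
Lemma asymptotic_chain (A : nat -> set G) :
    card_lt [set: K] [set: G] ->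
    (forall n, asymptotic_nbhd E (A n) (A n.+1)) ->
  card_lt (A 0%N) [set: K] \/ card_lt (~` A 4%N) [set: K].
Proof.
move=> [KG GK] chainA; apply: contrapT => /not_orP[].
move=> /not_card_lt_inj[f finj fA] /not_card_lt_inj[g ginj gA].
pose bad k := [set x | A 1%N (f k * x * 1) /\ ~ A 2%N (1 * x * 1)] `|`
  [set x | A 2%N (1 * x * 1) /\ ~ A 3%N (g k * x * 1)].
have [x xbad] : exists x, ~ (\bigcup_(k in [set: K]) bad k) x.
  apply: contrapT => /forallNP allbad; apply: GK.
  apply: card_le_trans (card_le_bigcup Kinf (card_lexx _) _).
    by apply: subset_card_le => x _; exact: contrapT (allbad x).
  move=> k _; apply: card_le_setU => //; first exact: card_setX_infinite.
    by have [] := asymptotic_nbhd_translates (f k) 1 1 1 (chainA 1%N).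
  by have [] := asymptotic_nbhd_translates 1 1 (g k) 1 (chainA 2%N).
have [k fk] := card_lt_notin finj
  (asymptotic_nbhd_translates 1 1 1 x (chainA 0%N)).
have [l gl] := card_lt_notin ginj
  (asymptotic_nbhd_translates 1 x 1 1 (chainA 3%N)).
have A1 : A 1%N (f k * x * 1).
  by apply: contrapT => nA; apply: fk; rewrite /= !mul1g !mulg1 in nA *.
have A2 : A 2%N (1 * x * 1).
  by apply: contrapT => nA; apply: xbad; exists k => //; left.
have A3 : A 3%N (g l * x * 1).
  by apply: contrapT => nA; apply: xbad; exists l => //; right.
apply: gl; rewrite /= !mul1g !mulg1 in A3 *; split=> //; exact: gA.
Qed.

End BalancedGroup.

(** * Convergence at infinity of slowly oscillating functions *)

Section SlowlyOscillating.
Set Implicit Arguments.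
Unset Strict Implicit.
Import Order.TTheory GRing.Theory Num.Theory.
Local Open Scope card_scope.
Local Open Scope ring_scope.
Variables (R : realType) (G : groupType) (K : Type).
Variables (Kinf : infinite_set [set: K]) (KG : card_lt [set: K] [set: G]).
Variable h : G -> R.
Hypothesis hso : slowly_oscillating (balanced_coarse G Kinf) h.

Lemma slowly_oscillating_levels (a b : R) : a < b ->
  card_lt [set x | h x < a] [set: K] \/ card_lt [set x | b <= h x] [set: K].
Proof.
(* Quarter steps make [A 0] and [A 4] the sublevel sets of a and b, the two ends compared by
   [asymptotic_chain]. *)
move=> ab; pose A n := [set x | h x < a + (b - a) / 4 * n%:R].
have [|small|small] := @asymptotic_chain G K Kinf A KG.
- move=> n; apply: slowly_oscillating_nbhd => //.
  by rewrite ltrD2l ltr_pM2l ?ltr_nat //; lra.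
- by left; move: small; rewrite /A mulr0 addr0.
right; congr card_lt : small; apply/seteqP; split=> x /=.
  by move=> /negP; rewrite -leNgt; apply: le_trans; lra.
by move=> bx; apply/negP; rewrite -leNgt; apply: le_trans bx; lra.
Qed.

(** Since kappa may have countable cofinality, the union is only bounded by kappa itself; kappa <
    |G| concludes. *)
Lemma card_lt_cover (A : nat -> set G) :
  (forall n, card_lt (A n) [set: K]) -> exists x, forall n, ~ A n x.
Proof.
move=> AK; apply: contrapT => /forallNP allA; have [_] := KG; apply.
apply: card_le_trans (card_le_bigcup Kinf (D := [set: nat]) (A := A) _ _).
- by apply: subset_card_le => x _; have /existsNP[n /contrapT Anx] := allA x;
    exists n.
- exact/infiniteP.
- by move=> n _; have [] := AK n.
Qed.

Lemma slowly_oscillating_convergent : convergent_at_infinity K h.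
Proof.
pose S := [set a | card_lt [set x | h x < a] [set: K]].
have down a b : a <= b -> S b -> S a.
  move=> ab Sb; apply: card_le_lt Sb; apply: subset_card_le => x /= hx.
  exact: lt_le_trans ab.
have archi x : - (Num.bound `|h x|)%:R <= h x < (Num.bound `|h x|)%:R.
  have := archi_boundP (normr_ge0 (h x)); rewrite ltr_norml.
  by move=> /andP[/ltW -> ->].
(* If [S] were empty, all sets {-n <= h} would be small; if it were unbounded above, all sets {h <
   n} would be. Either family covers [G]. *)
have Ssup : has_sup S.
  split.
    apply: contrapT => S0.
    have [n|x /(_ (Num.bound `|h x|))] :=
        @card_lt_cover (fun n => [set x | - n%:R <= h x]).
      have [|Sn|//] := @slowly_oscillating_levels (- n%:R - 1) (- n%:R).
        by lra.
      by exfalso; apply: S0; exists (- n%:R - 1).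
    by rewrite /=; case/andP: (archi x) => ->.
  apply: contrapT => Sub.
  have [n|x /(_ (Num.bound `|h x|))] :=
      @card_lt_cover (fun n => [set x | h x < n%:R]).
    apply: contrapT => Sn; apply: Sub; exists n%:R => b Sb.
    by rewrite leNgt; apply/negP => /ltW nb; apply: Sn; exact: down Sb.
  by rewrite /=; case/andP: (archi x) => _ ->.
exists (sup S) => e e0.
have low : card_lt [set x | h x < sup S - e] [set: K].
  have [b Sb eb] := sup_adherent e0 Ssup.
  exact: down (ltW eb) Sb.
have high : card_lt [set x | sup S + e <= h x] [set: K].
  (* The lower level exceeds the supremum, so its sublevel set is not small. *)
  have [||//] := @slowly_oscillating_levels (sup S + e / 2) (sup S + e).
    by lra.
  move=> /(ub_le_sup (proj2 Ssup)); lra.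
apply: card_le_lt (proj1 (balanced_boundedP Kinf _)
  (coarse_boundedU (proj2 (balanced_boundedP Kinf _) low)
                   (proj2 (balanced_boundedP Kinf _) high))).
apply: subset_card_le => x; rewrite /= ltr_normr => /orP[] hx.
  by right; rewrite /=; lra.
by left; rewrite /=; lra.
Qed.

End SlowlyOscillating.

Theorem theorem1 (R : realType) (G : groupType) (K : Type)
    (Ginf : infinite_set [set: G]) (Kinf : infinite_set [set: K])
    (KG : card_lt [set: K] [set: G]) :
  (forall h : G -> R, slowly_oscillating (balanced_coarse G Kinf) h ->
     convergent_at_infinity K h) /\
  (exists c : corona (balanced_coarse G Kinf),
     [set: corona (balanced_coarse G Kinf)] = [set c]).
Proof.
split; first by move=> h; exact: slowly_oscillating_convergent.
(* X^sharp has a point because kappa < |G| makes [G] unbounded; its class is the single point of the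
   corona. *)
have [|q _] := @sharp_unbounded _ (balanced_coarse G Kinf) (1%g : G) setT.
  by move=> /balanced_boundedP GK; case: KG => _; apply; case: GK.
exists (\pi_(corona (balanced_coarse G Kinf)) q)%qT.
apply/seteqP; split=> // c _; rewrite -[c]reprK.
apply/eqmodP/asboolP; apply: contrapT.
have [Seq Scl Spar _] := corona_relP (balanced_coarse G Kinf).
move=> nS.
have [A [A0 chainA A4]] := closed_equivalence_chain Seq Scl Spar (1%g : G) nS.
have [small|small] := asymptotic_chain KG chainA.
  exact: sharpP A0 (proj2 (balanced_boundedP _ _) small).
exact: sharpP (A4 4%N) (proj2 (balanced_boundedP _ _) small).
Qed.
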